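(* Let $n\ge 3$ and let $R$ be a ring. Let $R^*$ denote the set of all right invertible elements of $R$, and suppose that for any $x,z\in R$ there is a $y\in R^*$ such that $1+xyz\in R^*$ (which is true e.g. if $R$ is a Banach algebra). Let $\sigma\in \mathrm{GL}_n(R)$, let $i,j,k,l\in\{1,\dots,n\}$ with $i\neq j$ and $k\neq l$, and let $a,b,c\in R$. Then (i) $t_{kl}(a\sigma_{ij}b)$ is a product of $160$ $\mathrm{E}_n(R)$-conjugates of $\sigma$ and $\sigma^{-1}$, and (ii) $t_{kl}(a(c\sigma_{ii}-\sigma_{jj}c)b)$ is a product of $480$ $\mathrm{E}_n(R)$-conjugates of $\sigma$ and $\sigma^{-1}$.
   Context: Rings are associative with $1\neq 0$, not necessarily commutative. A Banach algebra is an algebra $R$ (here with $1\ne 0$) over the real or complex numbers that is also a complete normed vector space with $\|xy\|\le\|x\|\,\|y\|$ for all $x,y\in R$. An element $x\in R$ is right invertible if $xx'=1$ for some $x'\in R$. $\mathrm{GL}_n(R)$ is the group of invertible $n\times n$ matrices over $R$; $\sigma_{ij}$ is the $(i,j)$ entry of $\sigma$. For $i\ne j$ and $x\in R$, $t_{ij}(x)=e+xe^{ij}$, where $e$ is the identity matrix and $e^{ij}$ is the matrix with $1$ at position $(i,j)$ and $0$ elsewhere. $\mathrm{E}_n(R)$ is the subgroup of $\mathrm{GL}_n(R)$ generated by all $t_{ij}(x)$ ($i\neq j$, $x\in R$). For $g,h$ in a group, $g^h=h^{-1}gh$. ''A product of $m$ $\mathrm{E}_n(R)$-conjugates of $\sigma$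 and $\sigma^{-1}$'' means a product of $m$ factors, each of the form $\sigma^{\xi}$ or $(\sigma^{-1})^{\xi}$ with $\xi\in \mathrm{E}_n(R)$. *)

(* Defs.v *)
From HB Require Import structures.
From mathcomp Require Import all_boot all_order all_algebra.
From mathcomp Require Import all_classical all_reals topology normedtype.
From mathcomp Require Import complex.
Set Implicit Arguments.
Unset Strict Implicit.
Unset Printing Implicit Defensive.
Import Order.TTheory GRing.Theory Num.Theory.
Import numFieldNormedType.Exports.
Local Open Scope ring_scope.

(* [unitmx] needs a commutative ring, so over an arbitrary ring an invertible
   matrix is packed together with its two-sided inverse. *)
Record GL (n : nat) (R : nzRingType) := GLpair {
  GLpairval : 'M[R]_n * 'M[R]_n;
  _ : (GLpairval.1 *m GLpairval.2 == 1%:M)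
      && (GLpairval.2 *m GLpairval.1 == 1%:M) }.

HB.instance Definition _ (n : nat) (R : nzRingType) :=
  [isSub for @GLpairval n R].
HB.instance Definition _ (n : nat) (R : nzRingType) :=
  [Choice of GL n R by <:].

Section GLGroup.
Variables (n : nat) (R : nzRingType).
Implicit Types g h : GL n R.

Definition GLval g : 'M[R]_n := (val g).1.
Definition GLinvval g : 'M[R]_n := (val g).2.
Coercion GLval : GL >-> matrix.

Lemma GLvalV g : GLval g *m GLinvval g = 1%:M.
Proof. by rewrite /GLval /GLinvval; case: g => p /= /andP[/eqP->]. Qed.

Lemma GLVval g : GLinvval g *m GLval g = 1%:M.
Proof. by rewrite /GLval /GLinvval; case: g => p /= /andP[_ /eqP->]. Qed.

Lemma GLval_inj : injective GLval.
Proof.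
move=> g h eq_gh; apply: val_inj.
have eqV : GLinvval g = GLinvval h.
  rewrite -[LHS]mulmx1 -(GLvalV h) mulmxA -eq_gh GLVval mul1mx //.
move: eq_gh eqV; rewrite /GLval /GLinvval.
by case: (val g) (val h) => [? ?] [? ?] /= -> ->.
Qed.

Definition GLmk (A B : 'M[R]_n) (AB : A *m B = 1%:M) (BA : B *m A = 1%:M) :
  GL n R := @GLpair n R (A, B) (introT andP (conj (introT eqP AB) (introT eqP BA))).

Definition GLone : GL n R := GLmk (mul1mx 1%:M) (mul1mx 1%:M).

Definition GLinv g : GL n R := GLmk (GLVval g) (GLvalV g).

Lemma GLmul_subproof g h :
  (GLval g *m GLval h) *m (GLinvval h *m GLinvval g) = 1%:M.
Proof. by rewrite mulmxA -(mulmxA (GLval g)) GLvalV mulmx1 GLvalV. Qed.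

Lemma GLmulV_subproof g h :
  (GLinvval h *m GLinvval g) *m (GLval g *m GLval h) = 1%:M.
Proof. by rewrite mulmxA -(mulmxA (GLinvval h)) GLVval mulmx1 GLVval. Qed.

Definition GLmul g h : GL n R :=
  GLmk (GLmul_subproof g h) (GLmulV_subproof g h).

Lemma GLmulA : associative GLmul.
Proof. by move=> g h k; apply: GLval_inj; apply: mulmxA. Qed.

Lemma GLmul1g : left_id GLone GLmul.
Proof. by move=> g; apply: GLval_inj; apply: mul1mx. Qed.

Lemma GLmulg1 : right_id GLone GLmul.
Proof. by move=> g; apply: GLval_inj; apply: mulmx1. Qed.

Lemma GLmulVg : left_inverse GLone GLinv GLmul.
Proof. by move=> g; apply: GLval_inj; apply: GLVval. Qed.

Lemma GLmulgV : right_inverse GLone GLinv GLmul.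
Proof. by move=> g; apply: GLval_inj; apply: GLvalV. Qed.

HB.instance Definition _ :=
  isGroup.Build (GL n R) GLmulA GLmul1g GLmulg1 GLmulVg GLmulgV.

Lemma GLval1 : GLval 1%g = 1%:M. Proof. by []. Qed.

Lemma GLvalM g h : GLval (g * h)%g = GLval g *m GLval h. Proof. by []. Qed.

Lemma GLval_inv g : GLval g^-1%g = GLinvval g. Proof. by []. Qed.

Definition transvection (i j : 'I_n) (x : R) : 'M[R]_n :=
  1%:M + x *: delta_mx i j.

Lemma transvection_mulN (i j : 'I_n) (x : R) : i != j ->
  transvection i j x *m transvection i j (- x) = 1%:M.
Proof.
move=> ij; rewrite /transvection mulmxDl mul1mx mulmxDr mulmx1.
rewrite -scalemxAl.
suff -> : delta_mx i j *m (- x *: delta_mx i j) = 0 :> 'M[R]_n.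
  by rewrite scaler0 addr0 scaleNr -addrA addNr addr0.
apply/matrixP=> u v; rewrite !mxE big1// => w _; rewrite !mxE.
case: (w =P j) => [->|_]; last by rewrite andbF mul0r.
by rewrite (eq_sym j) (negPf ij) /= mulr0 mulr0.
Qed.

Lemma transvection_Nmul (i j : 'I_n) (x : R) : i != j ->
  transvection i j (- x) *m transvection i j x = 1%:M.
Proof. by move=> ij; rewrite -{2}(opprK x) transvection_mulN. Qed.

Definition GLtransvection (i j : 'I_n) (ij : i != j) (x : R) : GL n R :=
  GLmk (transvection_mulN x ij) (transvection_Nmul x ij).

Inductive elementary : GL n R -> Prop :=
| elementary_t i j (ij : i != j) x : elementary (GLtransvection ij x)
| elementary_1 : elementary 1%g
| elementary_M g h : elementary g -> elementary h -> elementary (g * h)%g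
| elementary_V g : elementary g -> elementary g^-1%g.

Definition is_elementary_conj (sigma g : GL n R) : Prop :=
  exists2 xi, elementary xi & g = (sigma ^ xi)%g \/ g = (sigma^-1 ^ xi)%g.

Definition is_prod_elementary_conj (m : nat) (sigma g : GL n R) : Prop :=
  exists f : 'I_m -> GL n R,
    (forall r, is_elementary_conj sigma (f r)) /\ g = (\prod_(r < m) f r)%g.

End GLGroup.

Definition right_invertible (R : nzRingType) (x : R) : Prop :=
  exists x', x * x' = 1.

Definition right_inv_condition (R : nzRingType) : Prop :=
  forall x z : R, exists y : R,
    right_invertible y /\ right_invertible (1 + x * y * z).

(* The norm of a [completeNormedModType K] has values in [K]. A structure
   inheriting both from it and from [algType K] is rejected by HB, because
   [numDomainType] is already declared as the join of their norm and ring
   parts; hence the product is added to the normed space by a record, and the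
   resulting algebra lives on the normless alias [banach_alg]. *)
Record banachAlgebra (K : numFieldType) := BanachAlgebra {
  banach_space :> completeNormedModType K;
  bmul : banach_space -> banach_space -> banach_space;
  bone : banach_space;
  bmulA : associative bmul;
  bmul1x : left_id bone bmul;
  bmulx1 : right_id bone bmul;
  bmulDl : left_distributive bmul +%R;
  bmulDr : right_distributive bmul +%R;
  bone_neq0 : bone != 0;
  bmulZl : forall (k : K) x y, k *: bmul x y = bmul (k *: x) y;
  bmulZr : forall (k : K) x y, k *: bmul x y = bmul x (k *: y);
  bnormM : forall x y, `|bmul x y| <= `|x| * `|y| }.

Definition banach_alg (K : numFieldType) (B : banachAlgebra K) : Type := B.

Section BanachAlg.
Variables (K : numFieldType) (B : banachAlgebra K).

HB.instance Definition _ := GRing.Lmodule.copy (banach_alg B) (B : lmodType K).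
HB.instance Definition _ := GRing.Zmodule_isNzRing.Build (banach_alg B)
  (@bmulA K B) (@bmul1x K B) (@bmulx1 K B) (@bmulDl K B) (@bmulDr K B)
  (@bone_neq0 K B).
HB.instance Definition _ :=
  GRing.Lmodule_isLalgebra.Build K (banach_alg B) (@bmulZl K B).
HB.instance Definition _ :=
  GRing.Lalgebra_isAlgebra.Build K (banach_alg B) (@bmulZr K B).

End BanachAlg.

(* Main.v *)
Require Import Defs.
From HB Require Import structures.
From mathcomp Require Import all_boot all_order all_algebra.
From mathcomp Require Import all_classical all_reals topology normedtype.
From mathcomp Require Import complex.
Import Order.TTheory GRing.Theory Num.Theory.
Import numFieldNormedType.Exports.
Local Open Scope ring_scope.

(** The heart of the proof is a reversed decomposition of unipotents.  Suppose
that a column [x] with [x_j = 0] is annihilated by row [i] of [s], [i != j].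
Then [tau = 1 + x e_j] is elementary, and [s tau s^-1] has a trivial row [i],
so that it conjugates a transvection in column [i] into a matrix differing
from [1] in column [i] only.  All these matrices commute with each other, and
two nested commutators, one to create them and one to kill them, leave exactly
[t_ki(a x_i b)], as a product of [8] conjugates
([annihilated_row_transvection]).  For [n >= 3] all positions [(k, l)] are
conjugate up to elementary matrices, so an entry obtained this way is obtained
everywhere.  The length needed is its cost; costs add up along sums and are
insensitive to two-sided multiplication ([ideal_cost]).

When [h_ii] is right invertible, solving the equation [h_ii x_i + ... = 0] for
[x_i] shows that every combination of the off-diagonal entries of row [i]
has cost [16] ([right_invertible_diag_cost]).  The hypothesis on the ring
makes this applicable to [h = [s, t_pq(y)]], for which
[h_ii = 1 + s_ip y (s^-1)_qi] ([commutator_cost], cost [32]).  Fix [i != p],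
let [q] be a third index and put [A = s_ip y], [B = (s^-1)_qi], [C = s_iq].
Choosing the columns of [s] as coefficients, and using [s^-1 s = 1], one gets
that [A B s_ii] and [A (1 - B C)] have cost [32].  Applied to a transvection
in row [i] instead, the same commutator shows that [1 - s_ii d] has cost [32]
for some [d].  Hence [A B = A B s_ii d + A B (1 - s_ii d)] has cost [64],
[A = A (1 - B C) + A B C] has cost [96], and so does [s_ip] since [y] is right
invertible ([off_diagonal_cost]).  Padding with the product [s s^-1 = 1]
gives [160].  For diagonal entries, entry [(j, i)] of a conjugate of [s] by
[t_ji(- c)] is [s_ji + (c s_ii - s_jj c) - c s_ij c], and three off-diagonal
entries are used.

In a Banach algebra a small enough nonzero scalar can be taken for [y]:
[1 + x y z] is then right invertible by the Neumann series. *)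

Set Implicit Arguments.
Unset Strict Implicit.
Unset Printing Implicit Defensive.

(* Not the homonymous coercion from the finite groups ['GL_n[R]]. *)
Local Notation GLval := Defs.GLval.

(** * Products of elementary conjugates *)

Section ConjugateProducts.
Variables (n : nat) (R : nzRingType).
Implicit Types (s g h x xi : GL n R) (m : nat).

Lemma prod_conj_ind s (P : nat -> GL n R -> Prop) :
    P 0%N 1%g ->
    (forall m x g, is_elementary_conj s x -> P m g -> P m.+1 (x * g)%g) ->
  forall m g, is_prod_elementary_conj m s g -> P m g.
Proof.
move=> P0 PS m g [f [fP ->{g}]]; elim: m f fP => [|m IHm] f fP.
  by rewrite big_ord0.
by rewrite big_ord_recl; apply: PS => //; apply: IHm.
Qed.

Lemma prod_conj0 s : is_prod_elementary_conj 0 s 1%g.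
Proof. by exists (fun=> 1%g); rewrite big_ord0; split=> // -[]. Qed.

Lemma prod_conj1 s g : is_elementary_conj s g -> is_prod_elementary_conj 1 s g.
Proof. by move=> sg; exists (fun=> g); rewrite big_ord1. Qed.

Lemma prod_conjM s m1 m2 g1 g2 :
    is_prod_elementary_conj m1 s g1 -> is_prod_elementary_conj m2 s g2 ->
  is_prod_elementary_conj (m1 + m2) s (g1 * g2)%g.
Proof.
move=> [f1 [f1P ->]] [f2 [f2P ->]].
exists (fun r => match fintype.split r with inl i => f1 i | inr i => f2 i end).
split=> [r|]; first by case: fintype.split.
rewrite big_split_ord; congr (_ * _)%g; apply: eq_bigr => i _.
  case: splitP => j /= e; first by congr f1; apply: val_inj.
  by move: (ltn_ord i); rewrite e ltnNge leq_addr.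
case: splitP => j /= e; last by congr f2; apply: val_inj; apply: (addnI e).
by move: (ltn_ord j); rewrite -e ltnNge leq_addr.
Qed.

Lemma elementary_conjJ s g xi :
  is_elementary_conj s g -> elementary xi -> is_elementary_conj s (g ^ xi)%g.
Proof.
move=> [eta Eeta sg] Exi; exists (eta * xi)%g; first exact: elementary_M.
by case: sg => ->; [left|right]; rewrite conjgM.
Qed.

Lemma elementary_conjV s g :
  is_elementary_conj s g -> is_elementary_conj s g^-1%g.
Proof.
by move=> [xi Exi [] ->]; exists xi => //; rewrite -conjVg ?invgK; auto.
Qed.

Lemma prod_conjJ s m g xi :
    is_prod_elementary_conj m s g -> elementary xi ->
  is_prod_elementary_conj m s (g ^ xi)%g.
Proof.
move=> sg Exi; elim/prod_conj_ind: sg => [|{}m x {}g sx IHg].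
  by rewrite conj1g; apply: prod_conj0.
rewrite conjMg -add1n; apply: prod_conjM IHg.
exact/prod_conj1/elementary_conjJ.
Qed.

Lemma prod_conjV s m g :
  is_prod_elementary_conj m s g -> is_prod_elementary_conj m s g^-1%g.
Proof.
move=> sg; elim/prod_conj_ind: sg => [|{}m x {}g sx IHg].
  by rewrite invg1; apply: prod_conj0.
rewrite invgM -addn1; apply: prod_conjM IHg _.
exact/prod_conj1/elementary_conjV.
Qed.

Lemma prod_conj_trans s h g m1 m2 :
    is_prod_elementary_conj m1 s h -> is_prod_elementary_conj m2 h g ->
  is_prod_elementary_conj (m2 * m1) s g.
Proof.
move=> sh hg; elim/prod_conj_ind: hg => [|m x {}g [xi Exi hx] IHg].
  by rewrite mul0n; apply: prod_conj0.
rewrite mulSn; apply: prod_conjM IHg.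
by case: hx => ->; apply: prod_conjJ => //; apply: prod_conjV.
Qed.

Lemma self_conj s : is_elementary_conj s s.
Proof. by exists 1%g; [apply: elementary_1 | rewrite conjg1; left]. Qed.

(** The padding consists of cancelling pairs [s s^-1]. *)
Lemma prod_conj_pad s m k g :
  is_prod_elementary_conj m s g -> is_prod_elementary_conj (k.*2 + m) s g.
Proof.
move=> sg; elim: k => [|k IHk] //; rewrite doubleS -(mul1g g) -(mulgV s).
have /prod_conj1 ss := self_conj s.
apply: (@prod_conjM s 2 (k.*2 + m)) IHk.
by apply: (@prod_conjM s 1 1) (prod_conjV ss).
Qed.

(** This is where the factors come from: a commutator with an elementary
    matrix doubles the length, no matter how complicated [g] is. *)
Lemma prod_conj_commutator s m g xi :
    is_prod_elementary_conj m s g -> elementary xi ->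
  is_prod_elementary_conj (m + m) s (g * (xi * g^-1 * xi^-1))%g.
Proof.
move=> sg Exi; apply: prod_conjM => //.
rewrite -[X in (X * _ * _)%g]invgK -mulgA -conjgE.
by apply: prod_conjJ; [apply: prod_conjV | apply: elementary_V].
Qed.

End ConjugateProducts.

(** * Reversed decomposition of unipotents *)

Section MatrixForms.
Variables (n : nat) (R : nzRingType).
Implicit Types (s g h : GL n R) (i j k l p : 'I_n) (z a b : R).

Lemma transvection_conj g k l (kl : k != l) z :
  GLval (g * GLtransvection kl z * g^-1)%g
  = 1%:M + (GLval g *m (z *: delta_mx k 0 : 'cV_n)) *m ('e_l *m GLval g^-1%g).
Proof.
rewrite !GLvalM /= /GLtransvection {2}/GLval /= /transvection.
rewrite mulmxDr mulmx1 mulmxDl -GLvalM mulgV GLval1; congr (_ + _).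
by rewrite -(mul_delta_mx (0 : 'I_1)) scalemxAl !mulmxA.
Qed.

(** For fixed [i] these matrices form an abelian group isomorphic to the
    columns [u] with [u_i = 0]; equalities of group elements and commutations
    are reduced below to additions of columns. *)
Definition is_column_unipotent i (u : 'cV[R]_n) g :=
  u i 0 = 0 /\ GLval g = 1%:M + u *m 'e_i.

Lemma delta_mul_entry m i (u : 'M[R]_(n, m)) (j : 'I_m) :
  (delta_mx 0 i *m u : 'rV_m) 0 j = u i j.
Proof. by rewrite -rowE mxE. Qed.

Lemma delta_mul_col i (u : 'cV[R]_n) : delta_mx 0 i *m u = (u i 0)%:M :> 'M_1.
Proof. by rewrite [LHS]mx11_scalar delta_mul_entry. Qed.

Lemma column_unipotentM i u v g h :
    is_column_unipotent i u g -> is_column_unipotent i v h ->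
  is_column_unipotent i (u + v) (g * h)%g.
Proof.
move=> [u0 gE] [v0 hE]; split; first by rewrite mxE u0 v0 addr0.
rewrite GLvalM gE hE mulmxDl mul1mx mulmxDr mulmx1.
rewrite -mulmxA (mulmxA (delta_mx 0 i)) delta_mul_col v0.
by rewrite raddf0 mul0mx mulmx0 addr0 mulmxDl -addrA (addrC (v *m _)).
Qed.

Lemma column_unipotent_inj i u g h :
  is_column_unipotent i u g -> is_column_unipotent i u h -> g = h.
Proof. by move=> [_ gE] [_ hE]; apply: GLval_inj; rewrite gE hE. Qed.

Lemma column_unipotentV i u g :
  is_column_unipotent i u g -> is_column_unipotent i (- u) g^-1%g.
Proof.
move=> [u0 gE]; split; first by rewrite mxE u0 oppr0.
have h0 : (GLval g *m (1%:M - u *m 'e_i) = 1%:M).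
  rewrite gE mulmxDl mul1mx mulmxBr mulmx1.
  rewrite -mulmxA (mulmxA (delta_mx 0 i)) delta_mul_col u0.
  by rewrite raddf0 mul0mx mulmx0 subr0 subrK.
by rewrite -[LHS]mulmx1 -[X in _ *m X = _]h0 mulmxA -GLvalM mulVg GLval1 mul1mx mulNmx.
Qed.

Lemma column_unipotent_t k i (ki : k != i) z :
  is_column_unipotent i (z *: delta_mx k 0) (GLtransvection ki z).
Proof.
split; first by rewrite !mxE eq_sym (negPf ki) mulr0.
by rewrite -scalemxAl mul_delta_mx.
Qed.

Lemma column_unipotent_ex i (u : 'cV[R]_n) : u i 0 = 0 ->
  exists2 g, elementary g & is_column_unipotent i u g.
Proof.
move=> u0; pose E v := exists2 g, elementary g & is_column_unipotent i v g.
suff: E (\sum_p u p 0 *: delta_mx p 0).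
  suff -> : \sum_p u p 0 *: delta_mx p 0 = u by [].
  by rewrite [RHS]matrix_sum_delta; apply: eq_bigr => p _; rewrite big_ord1.
apply: big_ind => [|v w [g Eg gv] [h Eh hw]|p _].
- exists 1%g; first exact: elementary_1.
  by split; rewrite ?mxE // mul0mx addr0.
- by exists (g * h)%g; [apply: elementary_M | apply: column_unipotentM].
have [->|pi] := eqVneq p i.
  rewrite u0 scale0r; exists 1%g; first exact: elementary_1.
  by split; rewrite ?mxE // mul0mx addr0.
exists (GLtransvection pi (u p 0)); first exact: elementary_t.
exact: column_unipotent_t.
Qed.

Lemma transvectionD k l (kl : k != l) a b :
  GLtransvection kl (a + b) = (GLtransvection kl a * GLtransvection kl b)%g.
Proof.
apply: (@column_unipotent_inj l ((a + b) *: delta_mx k 0)).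
  exact: column_unipotent_t.
by rewrite scalerDl; apply: column_unipotentM; apply: column_unipotent_t.
Qed.

Lemma transvectionN k l (kl : k != l) a :
  GLtransvection kl (- a) = (GLtransvection kl a)^-1%g.
Proof.
apply: (@column_unipotent_inj l ((- a) *: delta_mx k 0)).
  exact: column_unipotent_t.
by rewrite scaleNr; apply/column_unipotentV/column_unipotent_t.
Qed.

Lemma mul_scaled_delta_entry m (A : 'M[R]_(m, n)) k z (p : 'I_m) :
  (A *m (z *: delta_mx k 0 : 'cV_n)) p 0 = A p k * z.
Proof.
rewrite mxE (bigD1 k) //= big1 => [|q qk]; first by rewrite !mxE !eqxx mulr1 addr0.
by rewrite !mxE (negPf qk) !mulr0.
Qed.

(** A matrix whose row [i] is trivial normalizes the group of column [i]
    unipotents. *)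
Lemma column_unipotent_conj g k i (ki : k != i) z :
    'e_i *m GLval g = 'e_i :> 'rV_n ->
  is_column_unipotent i (GLval g *m (z *: delta_mx k 0 : 'cV_n))
    (g * GLtransvection ki z * g^-1)%g.
Proof.
move=> gi; split; last first.
  have giV : 'e_i *m GLval g^-1%g = 'e_i :> 'rV_n.
    by rewrite -[in LHS]gi -mulmxA -GLvalM mulgV mulmx1.
  by rewrite transvection_conj giV.
by rewrite -delta_mul_entry mulmxA gi delta_mul_entry !mxE eq_sym (negPf ki) mulr0.
Qed.

(** Reversed decomposition of unipotents.  With [tau = 1 + x e_j], the matrix
    [g = s tau s^-1] has a trivial row [i] because row [i] of [s] kills [x].
    Conjugating the commutator of [tau^-1 g] and [t_ki(a)] by [tau^-1] gives [G S]
    with [G = g t_ki(a) g^-1] in the abelian group of column [i] unipotents and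
    [S = tau t_ki(-a) tau^-1 = t_ki(-a) t_kj(a x_i)].  In the commutator of
    [G S] with [t_ji(b)] the uncontrolled factor [G] cancels, and the
    commutator of [t_kj(a x_i)] with [t_ji(b)] remains, which is
    [t_ki(a x_i b)]. *)
Lemma annihilated_row_transvection s i j k (ki : k != i) (x : 'cV[R]_n) a b :
    i != j -> k != j -> x j 0 = 0 -> (GLval s *m x) i 0 = 0 ->
  is_prod_elementary_conj 8 s (GLtransvection ki (a * x i 0 * b)).
Proof.
move=> ij kj xj0 sx0; have ji : j != i by rewrite eq_sym.
have [tau Etau tau_x] := @column_unipotent_ex j x xj0.
have tauV_x := column_unipotentV tau_x.
pose t := GLtransvection ki a; pose q := GLtransvection ji b.
pose g := (s * tau * s^-1)%g; pose S := (tau * t^-1 * tau^-1)%g.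
have Ec: is_prod_elementary_conj 4 s (g * t * g^-1 * S)%g.
  have sh : is_prod_elementary_conj 2 s (s ^ tau * s^-1)%g.
    apply: (@prod_conjM _ _ s 1 1); last exact/prod_conjV/prod_conj1/self_conj.
    exact/prod_conj1/elementary_conjJ/Etau/self_conj.
  have := prod_conjJ (prod_conj_commutator sh (elementary_t ki a))
    (elementary_V Etau).
  congr is_prod_elementary_conj; rewrite /S /g !conjgE !invgM !invgK !mulgA.
  by rewrite mulgV mul1g.
have eig : 'e_i *m GLval g = 'e_i :> 'rV_n.
  rewrite !GLvalM tau_x.2 mulmxDr mulmx1 mulmxDl -GLvalM mulgV GLval1.
  rewrite mulmxDr mulmx1 !mulmxA -(mulmxA 'e_i) delta_mul_col sx0.
  by rewrite raddf0 !mul0mx addr0.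
have eiTau : 'e_i *m GLval tau^-1%g = 'e_i - x i 0 *: 'e_j :> 'rV_n.
  by rewrite tauV_x.2 mulmxDr mulmx1 mulmxA delta_mul_col mxE mul_scalar_mx scaleNr.
have SE z : GLval (tau * GLtransvection ki z * tau^-1)%g
   = 1%:M + (z *: delta_mx k 0 : 'cV_n) *m ('e_i - x i 0 *: 'e_j).
  rewrite transvection_conj eiTau tau_x.2 mulmxDl mul1mx -(mulmxA x).
  by rewrite delta_mul_col !mxE eq_sym (negPf kj) mulr0 raddf0 mulmx0 addr0.
have eiS : 'e_i *m GLval S = 'e_i :> 'rV_n.
  rewrite /S -transvectionN SE mulmxDr mulmx1 mulmxA delta_mul_col.
  by rewrite !mxE eq_sym (negPf ki) mulr0 raddf0 mul0mx addr0.
have G_unip := column_unipotent_conj ki a eig.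
have Q_unip := column_unipotent_conj ji b eiS.
have := prod_conj_commutator Ec (elementary_t ji b).
congr is_prod_elementary_conj.
set G := (g * t * g^-1)%g in G_unip *; set Q := (S * _ * _)%g in Q_unip.
(* [G] depends on [s] in an uncontrolled way; commuting with [Q] removes it. *)
have GQ : (G * Q = Q * G)%g.
  apply: (column_unipotent_inj (column_unipotentM G_unip Q_unip)).
  by rewrite addrC; apply: column_unipotentM.
have -> : (G * S * (q * (G * S)^-1 * q^-1) = Q * q^-1)%g.
  transitivity (G * Q * G^-1 * q^-1)%g; first by rewrite /Q invgM !mulgA.
  by rewrite GQ mulgK.
apply: (@column_unipotent_inj i ((a * x i 0 * b) *: delta_mx k 0));
  last exact: column_unipotent_t.
suff -> : (a * x i 0 * b) *: delta_mx k 0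
       = GLval S *m (b *: delta_mx j 0) - (b *: delta_mx j 0) :> 'cV_n.
  by apply: column_unipotentM => //; apply/column_unipotentV/column_unipotent_t.
rewrite /S -transvectionN SE mulmxDl mul1mx addrAC subrr add0r -mulmxA.
apply/colP=> p; rewrite [RHS]mxE big_ord1 mul_scaled_delta_entry !mxE !eqxx (negPf ji).
case: (p == k) => /=; rewrite !(mulr1, mulr0, mul0r) // sub0r.
by rewrite (mulNr (x i 0)) mulrNN !mulrA.
Qed.

End MatrixForms.

(** * Moving a transvection to another position *)

Section Spreading.
Variables (n : nat) (R : nzRingType).
Implicit Types (s g h : GL n R) (i j k l p : 'I_n) (a b c z : R).

Lemma transvection_mul_col k l (kl : k != l) c z p :
  GLval (GLtransvection kl c) *m (z *: delta_mx p 0)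
  = z *: delta_mx p 0 + (if p == l then (c * z) *: delta_mx k 0 else 0) :> 'cV_n.
Proof.
have [_ ->] := column_unipotent_t kl c; rewrite mulmxDl mul1mx; congr (_ + _).
rewrite -mulmxA delta_mul_col; apply/colP=> q; rewrite mxE big_ord1.
have [->|/negPf pl] := eqVneq p l.
  rewrite !mxE !eqxx !andbT !mulr1 mulr1n.
  by case: (q == k); rewrite !(mulr1, mulr0, mul0r).
by rewrite !mxE [l == p]eq_sym pl /= mulr0 mul0rn mulr0.
Qed.

Lemma row_mul_transvection k l (kl : k != l) c p :
  'e_p *m GLval (GLtransvection kl c)
  = 'e_p + (if p == k then c *: 'e_l else 0) :> 'rV_n.
Proof.
have [_ ->] := column_unipotent_t kl c; rewrite mulmxDr mulmx1; congr (_ + _).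
rewrite mulmxA delta_mul_col !mxE eqxx andbT mul_scalar_mx.
by case: eqP; rewrite ?mulr1 // mulr0 scale0r.
Qed.

(** The witness is the Weyl element [t_{k'k}(1) t_{kk'}(-1) t_{k'k}(1)].  Its
    sign sits on the image of column [k'], so that moving a single
    index along [g] creates no sign. *)
Lemma elementary_swap k k' : k != k' -> exists2 g, elementary g &
  [/\ forall z, GLval g *m (z *: delta_mx k 0) = z *: delta_mx k' 0 :> 'cV_n,
      'e_k *m GLval g^-1%g = 'e_k' :> 'rV_n &
      forall p, p != k -> p != k' ->
        (forall z, GLval g *m (z *: delta_mx p 0) = z *: delta_mx p 0 :> 'cV_n)
        /\ 'e_p *m GLval g^-1%g = 'e_p :> 'rV_n].
Proof.
move=> kk'; have k'k : k' != k by rewrite eq_sym.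
pose g : GL n R := (GLtransvection k'k 1 * (GLtransvection kk' (- 1)
           * GLtransvection k'k 1))%g.
have rowV p q : 'e_q *m GLval g = 'e_p :> 'rV_n ->
    'e_p *m GLval g^-1%g = 'e_q :> 'rV_n.
  by move=> <-; rewrite -mulmxA -GLvalM mulgV mulmx1.
exists g; first by do 2?[apply: elementary_M]; apply: elementary_t.
split=> [z||p pk pk'].
- rewrite !GLvalM -!mulmxA.
  rewrite !(mulmxDr, transvection_mul_col, eqxx, negPf kk', negPf k'k,
    mul1r, mulN1r, addr0).
  by rewrite mulmx0 addr0 !scaleNr -opprD addrCA subrr addr0.
- apply: rowV; rewrite !GLvalM !mulmxA.
  rewrite !(mulmxDl, row_mul_transvection, eqxx, negPf kk', negPf k'k,
    scale1r, scaleN1r, mulNmx, addr0).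
  by rewrite mul0mx addr0 addrCA subrr addr0.
split=> [z|].
  rewrite !GLvalM -!mulmxA.
  by rewrite !(transvection_mul_col, negPf pk, negPf pk', addr0).
apply: rowV; rewrite !GLvalM !mulmxA.
by rewrite !(row_mul_transvection, negPf pk, negPf pk', addr0).
Qed.

Lemma transvection_row_move s m k k' l (kl : k != l) (k'l : k' != l) z :
    is_prod_elementary_conj m s (GLtransvection kl z) ->
  is_prod_elementary_conj m s (GLtransvection k'l z).
Proof.
move: kl; case: (eqVneq k k') => [->|kk'] kl.
  by rewrite (bool_irrelevance kl k'l).
have [g Eg [gk _ /(_ l)]] := elementary_swap kk'.
rewrite ![l == _]eq_sym => /(_ kl k'l)[_ gl].
move/prod_conjJ=> /(_ _ (elementary_V Eg)); congr is_prod_elementary_conj.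
apply: GLval_inj; rewrite conjgE invgK mulgA transvection_conj gk gl.
by rewrite -scalemxAl mul_delta_mx.
Qed.

Lemma transvection_col_move s m k l l' (kl : k != l) (kl' : k != l') z :
    is_prod_elementary_conj m s (GLtransvection kl z) ->
  is_prod_elementary_conj m s (GLtransvection kl' z).
Proof.
move: kl; case: (eqVneq l l') => [->|ll'] kl.
  by rewrite (bool_irrelevance kl kl').
have [g Eg [_ gl /(_ k kl kl')[gk _]]] := elementary_swap ll'.
move/prod_conjJ=> /(_ _ (elementary_V Eg)); congr is_prod_elementary_conj.
apply: GLval_inj; rewrite conjgE invgK mulgA transvection_conj gk gl.
by rewrite -scalemxAl mul_delta_mx.
Qed.

Lemma third_index i j : (3 <= n)%N -> exists k, k != i /\ k != j.
Proof.
move=> n3; have /card_gt0P[k] : (0 < #|~: [set i; j]|)%N.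
  rewrite cardsCs finset.setCK card_ord subn_gt0; apply: leq_trans n3.
  by rewrite cards2; case: (i != j).
by rewrite !inE negb_or => /andP[]; exists k.
Qed.

Lemma transvection_move s m k l k' l' (kl : k != l) (kl' : k' != l') z :
    (3 <= n)%N -> is_prod_elementary_conj m s (GLtransvection kl z) ->
  is_prod_elementary_conj m s (GLtransvection kl' z).
Proof.
move=> n3 skl.
(* Rows and columns move in an order that never makes the two indices equal. *)
have [k'l|k'l] := eqVneq k' l; last first.
  exact: transvection_col_move (transvection_row_move k'l skl).
move: kl'; rewrite {k'}k'l => kl'; have [l'k|l'k] := eqVneq l' k; last first.
  have kl'' : k != l' by rewrite eq_sym.
  exact: transvection_row_move (transvection_col_move kl'' skl).
move: kl'; rewrite {l'}l'k => lk; have [p [pk pl]] := third_index k l n3.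
have := transvection_col_move pk (transvection_row_move pl skl).
exact: transvection_row_move.
Qed.

End Spreading.

(** * Costs of matrix entries *)

Section Cost.
Variables (n : nat) (R : nzRingType).
Hypothesis n3 : (3 <= n)%N.
Implicit Types (s g h : GL n R) (i j k l p q : 'I_n) (a b c z y : R).

(** The factors [a] and [b] make the elements of bounded cost behave like the
    elements of a two-sided ideal, with a bookkeeping of the lengths. *)
Definition ideal_cost m s z := forall k l (kl : k != l) a b,
  is_prod_elementary_conj m s (GLtransvection kl (a * z * b)).

Lemma ideal_costD s m1 m2 z1 z2 :
    ideal_cost m1 s z1 -> ideal_cost m2 s z2 ->
  ideal_cost (m1 + m2) s (z1 + z2).
Proof.
move=> c1 c2 k l kl a b; rewrite mulrDr mulrDl transvectionD.
exact: prod_conjM.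
Qed.

Lemma ideal_costM s m z a b : ideal_cost m s z -> ideal_cost m s (a * z * b).
Proof. by move=> cz k l kl a' b'; rewrite !mulrA -(mulrA _ b); apply: cz. Qed.

Lemma ideal_cost_trans s h z m1 m2 :
    is_prod_elementary_conj m1 s h -> ideal_cost m2 h z ->
  ideal_cost (m2 * m1) s z.
Proof. by move=> sh hz k l kl a b; apply: prod_conj_trans sh _. Qed.

Lemma annihilated_row_cost s i j (x : 'cV[R]_n) :
    i != j -> x j 0 = 0 -> (GLval s *m x) i 0 = 0 ->
  ideal_cost 8 s (x i 0).
Proof.
move=> ij xj0 sx0 k l kl a b; have [p [pi pj]] := third_index i j n3.
apply: (@transvection_move _ _ _ _ p i k l pi) => //.
exact: annihilated_row_transvection ij pj xj0 sx0.
Qed.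

(** If [r] is a right inverse of [h_ii], replacing the coordinate [x_i = 0] by
    [- r (h x)_i] makes row [i] annihilate the column.  The new coordinate has
    cost [8], and so has its product by [- h_ii] on the left. *)
Lemma right_invertible_diag_cost8 h i j (x : 'cV[R]_n) :
    right_invertible (GLval h i i) -> i != j -> x i 0 = 0 -> x j 0 = 0 ->
  ideal_cost 8 h ((GLval h *m x) i 0).
Proof.
move=> [r hr] ij xi0 xj0; set z := (_ *m _) i 0.
pose x' : 'cV_n := x - (r * z) *: delta_mx i 0.
have ji : j != i by rewrite eq_sym.
have x'i : x' i 0 = - (r * z) by rewrite !mxE xi0 !eqxx mulr1 add0r.
have : ideal_cost 8 h (x' i 0).
  apply: (annihilated_row_cost ij).
    by rewrite !mxE xj0 (negPf ji) mulr0 subr0.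
  by rewrite mulmxBr mxE [X in _ + X]mxE mul_scaled_delta_entry mulrA hr mul1r subrr.
move/(ideal_costM (- GLval h i i) 1).
by rewrite x'i mulrNN mulrA hr mul1r mulr1.
Qed.

(** The condition [x_j = 0] is removed by splitting [x] into the part off [j] and
    the part at [j], which avoids another index [p]. *)
Lemma right_invertible_diag_cost h i (x : 'cV[R]_n) :
    right_invertible (GLval h i i) -> x i 0 = 0 ->
  ideal_cost 16 h ((GLval h *m x) i 0).
Proof.
move=> hr xi0; have [j [ji _]] := third_index i i n3.
have [p [pi pj]] := third_index i j n3.
pose x1 : 'cV_n := x j 0 *: delta_mx j 0.
have -> : x = (x - x1) + x1 by rewrite subrK.
rewrite mulmxDr mxE; apply: (@ideal_costD _ 8 8).
  apply: (@right_invertible_diag_cost8 _ _ j); rewrite ?[i == _]eq_sym //.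
    by rewrite !mxE xi0 [i == _]eq_sym (negPf ji) mulr0 subr0.
  by rewrite !mxE !eqxx mulr1 subrr.
apply: (@right_invertible_diag_cost8 _ _ p); rewrite ?[i == _]eq_sym //.
  by rewrite !mxE [i == _]eq_sym (negPf ji) mulr0.
by rewrite !mxE (negPf pj) mulr0.
Qed.

(** Row [i] of the commutator [h = [s, t_pq(y)]] is that of [s t_pq(y) s^-1],
    namely [e_i + s_ip y (s^-1)_q*], times [t_pq(- y)]; the change of variable
    [x -> t_pq(y) x] absorbs the last factor.  The case [p = i] is allowed. *)
Lemma commutator_cost s i p q (pq : p != q) y (x : 'cV[R]_n) :
    q != i -> right_invertible (1 + GLval s i p * y * GLval s^-1%g q i) ->
    (GLval (GLtransvection pq y) *m x) i 0 = 0 ->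
  ideal_cost 32 s (x i 0 + GLval s i p * y * (GLval s^-1%g *m x) q 0).
Proof.
move=> qi sr tx0; pose t := GLtransvection pq y.
pose h := (s * (t * s^-1 * t^-1))%g.
have sh : is_prod_elementary_conj 2 s h.
  apply: (@prod_conj_commutator _ _ s 1); last exact: elementary_t.
  exact/prod_conj1/self_conj.
have hx (v : 'cV[R]_n) : (GLval h *m (GLval t *m v)) i 0
    = v i 0 + GLval s i p * y * (GLval s^-1%g *m v) q 0.
  rewrite mulmxA -GLvalM /h -mulgA mulgVK mulgA.
  rewrite transvection_conj mulmxDl mul1mx mxE; congr (_ + _).
  by rewrite -!mulmxA mulmxA mxE big_ord1 mul_scaled_delta_entry delta_mul_entry.
have hii := hx (1 *: delta_mx i 0).
rewrite transvection_mul_col [i == q]eq_sym (negPf qi) addr0 in hii.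
have e1 : (1 *: delta_mx i 0 : 'cV[R]_n) i 0 = 1 by rewrite !mxE !eqxx mulr1.
rewrite !mul_scaled_delta_entry e1 !mulr1 in hii.
rewrite -hx; apply: (@ideal_cost_trans _ _ _ 2 16 sh).
by apply: right_invertible_diag_cost => //; rewrite hii.
Qed.

Lemma ideal_cost_eq m s z z' : ideal_cost m s z -> z = z' -> ideal_cost m s z'.
Proof. by move=> ? <-. Qed.

Lemma right_invertibleM a b :
  right_invertible a -> right_invertible b -> right_invertible (a * b).
Proof.
move=> [a' aa'] [b' bb']; exists (b' * a').
by rewrite mulrA -(mulrA a) bb' mulr1.
Qed.

(** All relations come from [commutator_cost]: twice with [t_pq(y)] and columns of
    [s] without their entry at [i], once with [t_iq(y0)]. *)
Lemma off_diagonal_cost s i p : right_inv_condition R -> i != p ->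
  ideal_cost 96 s (GLval s i p).
Proof.
move=> cR ip; have [q [qi qp]] := third_index i p n3.
have pq : p != q by rewrite eq_sym.
have iq : i != q by rewrite eq_sym.
pose B := GLval s^-1%g q i.
have [y [[y' yy'] Ay]] := cR (GLval s i p) B.
have [y0 [y0R Dy]] := cR (GLval s i i) B.
have colV r : GLval s^-1%g *m (GLval s *m (1 *: delta_mx r 0))
    = delta_mx r 0 :> 'cV_n.
  by rewrite mulmxA -GLvalM mulVg mul1mx scale1r.
(* The column is [s e_r] with its entry at [i] removed; [s^-1 s e_r = e_r]. *)
have offcol r : ideal_cost 32 s
    (GLval s i p * y * ((q == r)%:R - B * GLval s i r)).
  pose x : 'cV_n := GLval s *m (1 *: delta_mx r 0) - GLval s i r *: delta_mx i 0.
  have xi : x i 0 = 0.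
    by rewrite mxE [X in _ + X]mxE mul_scaled_delta_entry !mxE !eqxx !mulr1 subrr.
  have tx : (GLval (GLtransvection pq y) *m x) i 0 = 0.
    have [_ ->] := column_unipotent_t pq y.
    rewrite mulmxDl mul1mx mxE xi add0r -mulmxA mxE big_ord1 !mxE.
    by rewrite (negPf ip) mulr0 mul0r.
  apply: ideal_cost_eq (commutator_cost qi Ay tx) _.
  rewrite xi add0r mulmxBr colV mxE [X in _ + X]mxE mul_scaled_delta_entry.
  by rewrite !mxE eqxx andbT.
(* With [t_iq(y0)] and the column [e_q - y0 e_i] the element obtained is
   [s_ii y0 (s^-1)_qq - (1 + s_ii y0 B) y0], whose second term is right
   invertible: up to bounded cost, [s_ii] is right invertible. *)
have [d diag] : exists d, ideal_cost 32 s (1 - GLval s i i * d).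
  pose x : 'cV_n := 1 *: delta_mx q 0 - y0 *: delta_mx i 0.
  have xi : x i 0 = - y0 by rewrite !mxE !eqxx (negPf iq) mulr0 add0r mulr1.
  have tx : (GLval (GLtransvection iq y0) *m x) i 0 = 0.
    rewrite mulmxBr !transvection_mul_col eqxx (negPf iq) addr0 mulr1.
    by rewrite !mxE !eqxx (negPf iq) !mulr0 add0r mulr1 subrr.
  have := commutator_cost qi Dy tx.
  rewrite xi mulmxBr mxE [X in _ * (_ + X)]mxE !mul_scaled_delta_entry mulr1 => cE.
  have [r Er] := right_invertibleM Dy y0R.
  exists (y0 * GLval s^-1%g q q * r).
  apply: ideal_cost_eq (ideal_costM (-1) r cE) _.
  rewrite -[X in _ = X - _]Er -/B mulN1r opprD opprK mulrBr opprB addrA !mulrDl mul1r.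
  by rewrite mulNr !mulrA.
pose A := GLval s i p * y; pose C := GLval s i q.
have AB : ideal_cost 64 s (A * B).
  have := offcol i; rewrite (negPf qi) sub0r => /(ideal_costM (-1) d) ABd.
  have := ideal_costD ABd (ideal_costM (A * B) 1 diag).
  move/ideal_cost_eq; apply; rewrite -/A mulN1r !mulrN opprK mulr1 mulrBr mulr1 !mulrA.
  by rewrite addrC subrK.
have := offcol q; rewrite eqxx => ABC.
have := ideal_costM 1 y' (ideal_costD ABC (ideal_costM 1 C AB)).
move/ideal_cost_eq; apply; rewrite -/A !mul1r mulrBr mulr1 !mulrA subrK.
by rewrite -mulrA yy' mulr1.
Qed.

Lemma off_diagonal_transvection s i p k l (kl : k != l) a b :
    right_inv_condition R -> i != p ->
  is_prod_elementary_conj 160 s (GLtransvection kl (a * GLval s i p * b)).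
Proof.
move=> cR ip; apply: (@prod_conj_pad _ _ _ 96 32).
exact: off_diagonal_cost.
Qed.

(** Entry [(j, i)] of [s] conjugated by [t_ji(- c)] differs from the wanted
    [c s_ii - s_jj c] by multiples of the off-diagonal entries [s_ji], [s_ij]. *)
Lemma diagonal_difference_transvection s i j k l (kl : k != l) a b c :
    right_inv_condition R -> i != j ->
  is_prod_elementary_conj 480 s
    (GLtransvection kl (a * (c * GLval s i i - GLval s j j * c) * b)).
Proof.
move=> cR ij; have ji : j != i by rewrite eq_sym.
pose t := GLtransvection ji (- c).
have st : is_prod_elementary_conj 1 s (s ^ t)%g.
  by apply/prod_conj1/elementary_conjJ; [apply: self_conj | apply: elementary_t].
have st_ji : GLval (s ^ t)%g j i
   = GLval s j i + (c * GLval s i i - GLval s j j * c) - c * GLval s i j * c.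
  rewrite conjgE -transvectionN opprK !GLvalM.
  set M := _ *m _.
  have -> : M j i = ('e_j *m (M *m (1 *: delta_mx i 0 : 'cV_n)) : 'M_1) 0 0.
    by rewrite delta_mul_entry mul_scaled_delta_entry mulr1.
  rewrite /M -!mulmxA transvection_mul_col eqxx mulr1.
  rewrite mulmxA row_mul_transvection eqxx.
  rewrite mulmxDl -scalemxAl mxE [X in _ + X]mxE !delta_mul_entry mulmxDr.
  rewrite ![((_ + _ : 'cV_n) _ _)]mxE !mul_scaled_delta_entry !mulr1 mulrDr !mulrN !mulrA.
  by rewrite !addrA; congr (_ - _); rewrite addrAC.
have -> : a * (c * GLval s i i - GLval s j j * c) * b
  = a * GLval (s ^ t)%g j i * b
    + ((- a) * GLval s j i * b + (a * c) * GLval s i j * (c * b)).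
  rewrite st_ji !(mulrDr, mulrDl, mulrN, mulNr) !mulrA.
  by rewrite [- _ + _]addrC addrA subrK addrAC subrr add0r.
rewrite !transvectionD; apply: (@prod_conjM _ _ _ 160 320).
  by apply: (@prod_conj_trans _ _ _ _ _ 1 160 st); apply: off_diagonal_transvection.
by apply: (@prod_conjM _ _ _ 160 160); apply: off_diagonal_transvection.
Qed.

End Cost.

(** * Neumann series in Banach algebras *)

Section NeumannSeries.
Variables (K : numFieldType) (B : banachAlgebra K).
(* A field with an order and a norm need not be archimedean. *)
Hypothesis half_small : forall e : K, 0 < e -> exists n, 2^-1 ^+ n < e.
Implicit Types (x y w z : banach_alg B).

(** The ring structure and the norm live on two aliases of the same type. *)
Definition bnorm x : K := `|x : B|.

Lemma bnormD x y : bnorm (x + y) <= bnorm x + bnorm y.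
Proof. exact: ler_normD. Qed.

Lemma bnormN x : bnorm (- x) = bnorm x.
Proof. exact: (@normrN _ B). Qed.

Lemma bnorm_ge0 x : 0 <= bnorm x.
Proof. exact: normr_ge0. Qed.

Lemma bnormM x y : bnorm (x * y) <= bnorm x * bnorm y.
Proof. exact: bnormM. Qed.

Lemma bnormX x n : bnorm x <= 2^-1 -> bnorm (x ^+ n) <= bnorm 1 * 2^-1 ^+ n.
Proof.
move=> xh; elim: n => [|n IHn]; first by rewrite !expr0 mulr1.
rewrite exprSr (le_trans (bnormM _ _))// exprSr mulrA.
by apply: ler_pM => //; apply: bnorm_ge0.
Qed.

Lemma geometric_tail x n p : bnorm x <= 2^-1 ->
  bnorm (\sum_(i < n + p) x ^+ i - \sum_(i < n) x ^+ i)
    <= bnorm 1 * 2^-1 ^+ n * (2 - 2 * 2^-1 ^+ p).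
Proof.
move=> xh; elim: p => [|p IHp].
  by rewrite addn0 subrr expr0 mulr1 subrr mulr0 /bnorm normr0.
rewrite addnS big_ord_recr /= addrAC (le_trans (bnormD _ _))//.
apply: (le_trans (lerD IHp (bnormX _ xh))).
rewrite exprD mulrA -mulrDr.
rewrite ler_wpM2l ?mulr_ge0 ?bnorm_ge0 ?exprn_ge0 ?invr_ge0 ?ler0n//.
by rewrite exprS mulrA divff ?pnatr_eq0// mul1r mulr_natl mulr2n opprD addrA subrK.
Qed.

Local Open Scope classical_set_scope.

(** The partial sums of the series in [- w] are Cauchy by the geometric estimate.
    If [(1 + w) l - 1] had norm [D > 0] for their limit [l], a partial sum close
    enough to [l] would give the strict bound [D < D]. *)
Lemma right_invertible_1D_small w : bnorm w <= 2^-1 -> right_invertible (1 + w).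
Proof.
move=> wh; pose x := - w.
have xh : bnorm x <= 2^-1 by rewrite bnormN.
pose s (n : nat) : B := \sum_(i < n) x ^+ i.
have C0 : 0 < bnorm 1 by rewrite lt_def bnorm_ge0 andbT normr_eq0 oner_neq0.
have s_cvg : cvg (s @ \oo).
  apply: cauchy_cvg; apply: cauchy_exP => e e0.
  have [n ne] : exists n, 2^-1 ^+ n < e / (bnorm 1 * 2).
    by apply: half_small; rewrite divr_gt0 ?mulr_gt0.
  exists (s n); exists n => // m /= nm.
  rewrite -ball_normE /= distrC -(subnKC nm).
  apply: (le_lt_trans (geometric_tail n (m - n) xh)).
  rewrite ltr_pdivlMr ?mulr_gt0 // in ne; apply: le_lt_trans ne.
  rewrite mulrA [X in _ <= X * _]mulrC.
  rewrite ler_wpM2l ?mulr_ge0 ?bnorm_ge0 ?exprn_ge0 ?invr_ge0 ?ler0n//.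
  by rewrite gerBl mulr_ge0 ?exprn_ge0 ?invr_ge0 ?ler0n.
pose l := lim (s @ \oo) : B.
exists (l : banach_alg B); apply/eqP; rewrite -subr_eq0 -[_ == 0](@normr_eq0 _ B).
apply/negPn/negP => D0; set D := `|_| in D0.
have {}D0 : 0 < D by rewrite lt_def D0 normr_ge0.
pose M := bnorm (1 + w) + bnorm 1 + 1.
have M0 : 0 < M by rewrite ltr_wpDl ?addr_ge0 ?bnorm_ge0.
have [n1 n1P] := half_small (divr_gt0 D0 M0).
have [n2 _ n2P] : \forall n \near \oo, `|l - s n| < D / M.
  by move/cvgrPdist_lt: s_cvg; apply; rewrite divr_gt0.
pose n := maxn n1 n2.
have ln : `|l - s n| < D / M by apply: n2P; rewrite /= leq_maxr.
have xn : 2^-1 ^+ n < D / M.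
  apply: le_lt_trans n1P; rewrite ler_wiXn2l ?leq_maxl ?invr_ge0 ?ler0n //.
  by rewrite invf_le1 ?ler1n ?ltr0n.
have sE : (1 + w) * (s n : banach_alg B) = 1 - x ^+ n.
  by rewrite -[1 + w]opprK opprD -/x addrC mulNr -subrX1 opprB.
have DE : (1 + w) * (l : banach_alg B) - 1
    = (1 + w) * ((l : banach_alg B) - (s n : banach_alg B)) - x ^+ n.
  by rewrite mulrBr sE opprB addrA addrAC addrK.
suff : D < D by rewrite ltxx.
rewrite {1}/D [X in `|X|]DE (le_lt_trans (bnormD _ _))// bnormN.
have -> : D = bnorm (1 + w) * (D / M) + bnorm 1 * (D / M) + D / M.
  by rewrite -mulrDl -[X in _ = _ + X]mul1r -mulrDl mulrC divfK ?gt_eqF.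
rewrite -addrA ler_ltD //.
  by apply: (le_trans (bnormM _ _)); rewrite ler_wpM2l ?bnorm_ge0 ?(ltW ln).
apply: (le_lt_trans (bnormX _ xh)); rewrite -[X in X < _]addr0.
by rewrite ler_ltD ?divr_gt0 // ler_wpM2l ?bnorm_ge0 ?(ltW xn).
Qed.

(** The witness is a scalar small enough for [x y z] to have norm at most [1/2]. *)
Lemma banach_right_inv_condition : right_inv_condition (banach_alg B).
Proof.
move=> x z; pose c : K := 2 * (bnorm (x * z) + 1).
have c0 : 0 < c by rewrite mulr_gt0 ?ltr_wpDl ?bnorm_ge0.
exists (c^-1)%:A; split.
  by exists (c%:A); rewrite -scalerAl mul1r scalerA mulVf ?scale1r ?gt_eqF.
apply: right_invertible_1D_small; rewrite -scalerAr mulr1 -scalerAl.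
have -> : bnorm (c^-1 *: (x * z)) = c^-1 * bnorm (x * z).
  by rewrite /bnorm [LHS]normrZ gtr0_norm ?invr_gt0.
by rewrite mulrC ler_pdivrMr // /c mulrA mulVf ?pnatr_eq0// mul1r lerDl.
Qed.

End NeumannSeries.

Lemma half_small_real (F : realType) (e : F) : 0 < e -> exists n, 2^-1 ^+ n < e.
Proof.
move=> e0; have := archi_boundP (ltW (_ : 0 < e^-1)); rewrite invr_gt0 => /(_ e0) eb.
exists (Num.Def.archi_bound e^-1); rewrite exprVn invf_plt ?posrE ?exprn_gt0//.
by apply: (lt_trans eb); rewrite -natrX ltr_nat ltn_expl.
Qed.

Lemma half_small_complex (F : realType) (e : F[i]) :
  0 < e -> exists n, 2^-1 ^+ n < e.
Proof.
case: e => a b; rewrite ltcE /= => /andP[/eqP b0 a0]; rewrite b0.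
have [n na] := half_small_real a0; exists n.
suff -> : 2^-1 ^+ n = (2^-1 ^+ n)%:C%C :> F[i] by rewrite ltcR.
by rewrite rmorphXn fmorphV rmorph_nat.
Qed.

Theorem theorem16 :
  (forall (n : nat) (R : nzRingType), (3 <= n)%N -> right_inv_condition R ->
   forall (sigma : GL n R) (i j k l : 'I_n) (a b c : R)
     (ij : i != j) (kl : k != l),
   is_prod_elementary_conj 160 sigma
     (GLtransvection kl (a * sigma i j * b)) /\
   is_prod_elementary_conj 480 sigma
     (GLtransvection kl (a * (c * sigma i i - sigma j j * c) * b))) /\
  (forall (F : realType) (B : banachAlgebra F),
     right_inv_condition (banach_alg B)) /\
  (forall (F : realType) (B : banachAlgebra F[i]),
     right_inv_condition (banach_alg B)).
Proof.
split=> [n R n3 cR sigma i j k l a b c ij kl|].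
  split; first exact: off_diagonal_transvection.
  exact: diagonal_difference_transvection.
split=> F B; apply: banach_right_inv_condition.
  exact: half_small_real.
exact: half_small_complex.
Qed.
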